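(* Let $(\mathfrak g,[-,-],R)$ be a Rota-Baxter Lie algebra of weight $1$ over a field $\mathbf k$ of characteristic $p>0$, and let $\mathfrak g^{(p)}=\mathrm{span}_{\mathbf k}\{x^{p^k}\in\mathrm U(\mathfrak g)\mid x\in\mathfrak g,\ k\ge0\}$ be the Lie algebra of primitive elements of $\mathrm U(\mathfrak g)$, with commutator bracket and $p$-map the $p$-th power $(-)^p$ in $\mathrm U(\mathfrak g)$. Then $(\mathfrak g^{(p)},[-,-],(-)^p,R)$ is a restricted Rota-Baxter Lie algebra of weight $1$, where $R$ on $\mathfrak g^{(p)}$ denotes the restriction $R|_{\mathfrak g^{(p)}}$ of the extension of $R$ to $\mathrm U(\mathfrak g)$.
   Context: Convention: $\mathbf k$ is an algebraically closed field of prime characteristic $p$; everything is over $\mathbf k$. Rota-Baxter Lie algebra of weight $\lambda$: a Lie algebra with a linear map $R$ such that $[R(x),R(y)]=R([R(x),y])+R([x,R(y)])+\lambda R([x,y])$ for all $x,y$. Extension to $\mathrm U(\mathfrak g)$ (Goncharov): a Rota-Baxter operator $R$ of weight $1$ on $\mathfrak g$ extends to a well-defined linear map $R:\mathrm U(\mathfrak g)\to\mathrm U(\mathfrak g)$ determined by $R(1)=1$ and $R(xy)=R(x)R(y)-R([R(x),y])$ for $x\in\mathfrak g$, $y\in\mathrm U(\mathfrak g)$ (commutator in $\mathrm U(\mathfrak g)$). It is a coalgebra endomorphism (elements of $\mathfrak g$ primitive) satisfying $R(x)R(y)=R(x_1R(x_2)\,y\,S(R(x_3)))$ for all $x,y\in\mathrm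 U(\mathfrak g)$ (Sweedler notation, $S$ the antipode). Restricted Lie algebra: a Lie algebra $(\mathfrak g,[-,-])$ with a $p$-map $(-)^{[p]}:\mathfrak g\to\mathfrak g$ satisfying $(ax)^{[p]}=a^px^{[p]}$ for $a\in\mathbf k$, $[x^{[p]},y]=(\mathrm{ad}_x)^p(y)$, and $(x+y)^{[p]}=x^{[p]}+y^{[p]}+\sum_{i=1}^{p-1}s_i(x,y)$, where $i\,s_i(x,y)$ is the coefficient of $t^{i-1}$ in $(\mathrm{ad}_{tx+y})^{p-1}(x)\in\mathbf k[t]\otimes\mathfrak g$. For a composition $\alpha=(\alpha_1,\dots,\alpha_r)\vDash n$ (a tuple of positive integers with sum $n$, of length $\ell(\alpha)=r$), $C_\alpha=\prod_{k=1}^r\binom{\alpha_1+\cdots+\alpha_k-1}{\alpha_k-1}$. A restricted Rota-Baxter Lie algebra $(\mathfrak g,[-,-],(-)^{[p]},R)$ of weight $\lambda$ is a restricted Lie algebra with a Rota-Baxter operator $R$ of weight $\lambda$ such that $R(x^{[p]_R})=R(x)^{[p]}$ for all $x\in\mathfrak g$, where, with $x\rhd_Ry:=[R(x),y]$ and $x^{\rhd_Rk}:=x\rhd_R(x\rhd_R\cdots(x\rhd_Rx)\cdots)$ ($k$ copies of $x$, $x^{\rhd_R1}=x$), $$x^{[p]_R}:=\lambda^{p-1}x^{[p]}+\sum_{r=1}^{p-1}\frac1r\lambda^{r-1}\sum_{\alpha\vDash p,\ \ell(\alpha)=r}C_\alpha\,[x^{\rhd_R\alpha_1},[x^{\rhd_R\alpha_2},[\cdots[x^{\rhd_R\alpha_{r-1}},x^{\rhd_R\alpha_r}]\cdots]]]$$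 ($\frac1r$ is the inverse of $r$ modulo $p$). *)

(* Defs.v *)
From HB Require Import structures.
From mathcomp Require Import all_boot all_order all_algebra.
From mathcomp Require Import boolp.

Set Implicit Arguments.
Unset Strict Implicit.
Unset Printing Implicit Defensive.

Import GRing.Theory.
Local Open Scope ring_scope.

Record is_lie_algebra (k : fieldType) (L : lmodType k) (br : L -> L -> L) :
    Prop := IsLieAlgebra {
  lie_linearl : forall y, linear (fun x => br x y);
  lie_linearr : forall x, linear (br x);
  lie_alternating : forall x, br x x = 0;
  lie_jacobi : forall x y z,
    br x (br y z) + br y (br z x) + br z (br x y) = 0
}.

Record is_rota_baxter_lie (k : fieldType) (lam : k) (L : lmodType k)
    (br : L -> L -> L) (R : {linear L -> L}) : Prop := IsRotaBaxterLie {
  rb_lie : is_lie_algebra br;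
  rb_identity : forall x y,
    br (R x) (R y) = R (br (R x) y) + R (br x (R y)) + lam *: R (br x y)
}.

(* An element of k[t] (x) L is given by its sequence of coefficients, and
   [poly_br] extends the bracket of L k[t]-bilinearly. *)
Definition poly_br (k : fieldType) (L : lmodType k) (br : L -> L -> L)
    (f h : nat -> L) : nat -> L :=
  fun n => \sum_(i < n.+1) br (f i) (h (n - i)%N).

(* [nth 0 [:: y; x]] is t x + y and [nth 0 [:: x]] is the constant x. *)
Definition jacobson_s (k : fieldType) (L : lmodType k) (br : L -> L -> L)
    (p i : nat) (x y : L) : L :=
  (i%:R)^-1 *: iter p.-1 (poly_br br (nth 0 [:: y; x])) (nth 0 [:: x]) i.-1.

Record is_restricted_lie (k : fieldType) (p : nat) (L : lmodType k)
    (br : L -> L -> L) (pm : L -> L) : Prop := IsRestrictedLie {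
  restricted_lie : is_lie_algebra br;
  pmapZ : forall (a : k) x, pm (a *: x) = a ^+ p *: pm x;
  pmap_ad : forall x y, br (pm x) y = iter p (br x) y;
  pmapD : forall x y,
    pm (x + y) = pm x + pm y + \sum_(1 <= i < p) jacobson_s br p i x y
}.

Definition is_composition (n : nat) (a : seq nat) : bool :=
  all (leq 1%N) a && (sumn a == n).

Definition comp_coef (a : seq nat) : nat :=
  (\prod_(j < size a) 'C((sumn (take j.+1 a)).-1, (nth 0 a j).-1))%N.

Fixpoint nested_br (k : fieldType) (L : lmodType k) (br : L -> L -> L)
    (s : seq L) : L :=
  match s with
  | [::] => 0
  | [:: y] => y
  | y :: s' => br y (nested_br br s')
  end.

(* The power of x with n >= 1 factors for the product x |> y = [R x, y]. *)
Definition rhd_pow (k : fieldType) (L : lmodType k) (br : L -> L -> L)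
    (R : L -> L) (x : L) (n : nat) : L :=
  iter n.-1 (br (R x)) x.

(* The parts of a composition of p are at most p, so the compositions of p of
   length r are among the r-tuples over 'I_p.+1. *)
Definition pmapR (k : fieldType) (p : nat) (lam : k) (L : lmodType k)
    (br : L -> L -> L) (pm R : L -> L) (x : L) : L :=
  lam ^+ p.-1 *: pm x +
  \sum_(1 <= r < p) ((r%:R)^-1 * lam ^+ r.-1) *:
    \sum_(a : r.-tuple 'I_p.+1 | is_composition p (map val a))
      (comp_coef (map val a))%:R *:
        nested_br br (map (rhd_pow br R x) (map val a)).

Record is_restricted_rota_baxter_lie (k : fieldType) (p : nat) (lam : k)
    (L : lmodType k) (br : L -> L -> L) (pm : L -> L) (R : {linear L -> L}) :
    Prop := IsRestrictedRotaBaxterLie {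
  rrb_restricted : is_restricted_lie p br pm;
  rrb_rota_baxter : is_rota_baxter_lie lam br R;
  rrb_pmap : forall x, R (pmapR p lam br pm R x) = pm (R x)
}.

Definition lie_commutator (A : pzRingType) (a b : A) : A := a * b - b * a.

Record is_enveloping_algebra (k : fieldType) (g : lmodType k)
    (br : g -> g -> g) (U : algType k) (iota : {linear g -> U}) : Prop :=
  IsEnvelopingAlgebra {
  env_br : forall x y, iota (br x y) = lie_commutator (iota x) (iota y);
  env_universal : forall (A : algType k) (f : {linear g -> A}),
    (forall x y, f (br x y) = lie_commutator (f x) (f y)) ->
    exists F : {lrmorphism U -> A},
      (forall x, F (iota x) = f x) /\
      (forall G : {lrmorphism U -> A}, (forall x, G (iota x) = f x) -> G =1 F)
}.

Record is_rb_extension (k : fieldType) (g : lmodType k) (U : algType k)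
    (iota : {linear g -> U}) (R : {linear g -> g}) (RU : {linear U -> U}) :
    Prop := IsRBExtension {
  rb_ext_iota : forall x, RU (iota x) = iota (R x);
  rb_ext1 : RU 1 = 1;
  rb_extM : forall (x : g) (u : U),
    RU (iota x * u) =
    RU (iota x) * RU u - RU (lie_commutator (RU (iota x)) u)
}.

Definition in_span (k : fieldType) (V : lmodType k) (S : V -> Prop) : {pred V} :=
  fun u => `[< exists (n : nat) (c : 'I_n -> k) (v : 'I_n -> V),
    (forall i, S (v i)) /\ u = \sum_(i < n) c i *: v i >].

Lemma in_span_submod (k : fieldType) (V : lmodType k) (S : V -> Prop) :
  submod_closed (in_span S).
Proof.
split=> [|a u v /asboolP[m [c [x [Sx ->]]]] /asboolP[n [d [y [Sy ->]]]]].
  apply/asboolP; exists 0%N, (fun=> 0), (fun=> 0).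
  by split=> [[]|] //; rewrite big_ord0.
apply/asboolP; exists (m + n)%N.
exists (fun i => match split i with inl j => a * c j | inr j => d j end).
exists (fun i => match split i with inl j => x j | inr j => y j end).
split=> [i|]; first by case: (split i).
rewrite big_split_ord scaler_sumr; congr (_ + _); apply: eq_bigr => i _.
  by rewrite (unsplitK (inl i)) scalerA.
by rewrite (unsplitK (inr i)).
Qed.

HB.instance Definition _ (k : fieldType) (V : lmodType k) (S : V -> Prop) :=
  GRing.isSubmodClosed.Build k V (in_span S) (in_span_submod S).

Record span (k : fieldType) (V : lmodType k) (S : V -> Prop) :=
  Span { span_val : V; _ : span_val \in in_span S }.

HB.instance Definition _ (k : fieldType) (V : lmodType k) (S : V -> Prop) :=
  [isSub for @span_val k V S].
HB.instance Definition _ (k : fieldType) (V : lmodType k) (S : V -> Prop) :=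
  [Choice of span S by <:].
HB.instance Definition _ (k : fieldType) (V : lmodType k) (S : V -> Prop) :=
  [SubChoice_isSubLmodule of span S by <:].

Definition ppower_span (k : fieldType) (p : nat) (g : lmodType k)
    (U : algType k) (iota : {linear g -> U}) : lmodType k :=
  span (fun u : U => exists (x : g) (n : nat), u = iota x ^+ (p ^ n)).

(* Main.v *)
Require Import Defs.
From HB Require Import structures.
From mathcomp Require Import all_boot all_order all_algebra.
From mathcomp Require Import boolp.

Set Implicit Arguments.
Unset Strict Implicit.
Unset Printing Implicit Defensive.

Import GRing.Theory.
Local Open Scope ring_scope.

(* Let [r := R u] for [u] in the span.  The identity
   [R (u w) = R u R w - R [R u, w]] says that [R T = L_r R], where
   [T w := (u + r) w - w r] and [L_r] is left multiplication by [r].  Left and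
   right multiplications commute, so in characteristic p
   [T^p w = (u + r)^p w - w r^p], and [R T^p = L_r^p R] shows that
   [v := (u + r)^p - r^p] satisfies [R v = r^p] together with the same identity
   as [u].  By Jacobson's formula [v - u^p] is a Lie polynomial in [u] and [r].
   As brackets of elements of the span lie in the image of g, induction on the
   exponent of [x ^+ (p ^ n)] shows that [R] preserves the span and that its
   elements satisfy the identity; neither the coproduct of U nor the
   Poincare-Birkhoff-Witt theorem is needed.  Finally [v] is the value of
   [pmapR] at [u]: in Jacobson's sum, distribute the derivation [ad r] over the
   nested brackets; the coefficients [C_alpha] satisfy the resulting
   recurrence. *)

(** * Powers and Jacobson's formula in an associative algebra of characteristic p *)

(** Left and right multiplications commute, so the binomial theorem applies to their difference. *)
Lemma iter_mul_sub (A : nzRingType) (a b w : A) n :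
  iter n (fun u => a * u - u * b) w =
  \sum_(i < n.+1) (a ^+ (n - i) * w * (- b) ^+ i) *+ 'C(n, i).
Proof.
elim: n => [|n IHn]; first by rewrite big_ord1 !expr0 mul1r mulr1 bin0.
rewrite iterS IHn mulr_sumr mulr_suml -sumrN.
rewrite big_ord_recl [RHS]big_ord_recl !bin0 !subn0 !expr0 !mulr1 mulrA -exprS.
rewrite -addrA; congr (_ + _).
under [RHS]eq_bigr => i _ do rewrite lift0 binS mulrnDr subSS.
rewrite big_split [X in _ = X + _]big_ord_recr /= bin_small // mulr0n addr0.
congr (_ + _); apply: eq_bigr => i _.
  by rewrite /bump !add1n mulrnAr !mulrA -exprS subnSK.
by rewrite mulrnAl exprSr mulrN mulrN mulNrn mulrA.
Qed.

Lemma iter_mul_sub_pchar (A : nzRingType) p (a b w : A) : p \in [pchar A] ->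
  iter p (fun u => a * u - u * b) w = a ^+ p * w - w * b ^+ p.
Proof.
move=> chp; rewrite iter_mul_sub big_ord_recr /= subnn binn mul1r exprNn.
have p_gt0 := prime_gt0 (pcharf_prime chp).
rewrite (bigD1 (Ordinal p_gt0)) //= big1 => [|i i_neq0]; last first.
  by rewrite -mulr_natr (bin_lt_pcharf_0 chp) ?mulr0 // ltn_ord lt0n andbT.
(* The remaining sign is (-1)^p: it is -1 for odd p, and for p = 2 signs do not matter. *)
rewrite addr0 subn0 mulr1 bin0 mulrA -signr_odd.
congr (_ + _); case: (boolP (odd p)) => [|even_p]; first by rewrite expr1 mulrN1 mulNr.
have/even_prime [p2|] := pcharf_prime chp; last by rewrite (negbTE even_p).
by rewrite p2 in chp *; rewrite expr0 mulr1 oppr_pchar2.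
Qed.

Lemma iter_commutator_pchar (A : nzRingType) p (x y : A) : p \in [pchar A] ->
  iter p (lie_commutator x) y = lie_commutator (x ^+ p) y.
Proof. exact: iter_mul_sub_pchar. Qed.

(** By Pascal's rule two neighbouring coefficients add up to ['C(p, i.+1)], which is 0 modulo p, so
    each step flips the sign. *)
Lemma sign_bin_pred_pchar (A : nzRingType) p i : p \in [pchar A] -> (i < p)%N ->
  (-1) ^+ i * 'C(p.-1, i)%:R = 1 :> A.
Proof.
move=> chp; have p_gt0 := prime_gt0 (pcharf_prime chp).
elim: i => [|i IHi] lt_ip; first by rewrite bin0 mulr1.
rewrite -[RHS](IHi (ltnW lt_ip)) exprS mulN1r mulNr -mulrN; congr (_ * _).
apply/eqP; rewrite eqr_oppLR -addr_eq0 -natrD -binS prednK //.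
by rewrite (bin_lt_pcharf_0 chp).
Qed.

Lemma iter_commutator_pred_pchar (A : nzRingType) p (x y : A) :
  p \in [pchar A] ->
  iter p.-1 (lie_commutator x) y = \sum_(i < p) x ^+ (p.-1 - i) * y * x ^+ i.
Proof.
move=> chp; have p_gt0 := prime_gt0 (pcharf_prime chp).
rewrite iter_mul_sub prednK //; apply: eq_bigr => i _.
rewrite exprNn -mulr_natr -[LHS]mulrA -[_ * x ^+ i * _]mulrA commr_nat.
by rewrite [_ ^+ i * (_ * _)]mulrA sign_bin_pred_pchar ?mul1r.
Qed.

(** Leibniz rule with the order of factors kept, to match the sum in
    [iter_commutator_pred_pchar]. *)
Lemma deriv_exp_sum (A : nzRingType) (f : {poly A}) n :
  (f ^+ n)^`() = \sum_(i < n) f ^+ (n.-1 - i) * f^`() * f ^+ i.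
Proof.
elim: n => [|n IHn]; first by rewrite big_ord0 derivC.
rewrite exprS derivM IHn big_ord_recr /= subnn mul1r addrC; congr (_ + _).
rewrite mulr_sumr; apply: eq_bigr => i _.
by case: n i {IHn} => [[]//|n] i; rewrite !mulrA -exprS subSn // -ltnS.
Qed.

Lemma coef_commutator (A : nzRingType) (f h : {poly A}) i :
  (lie_commutator f h)`_i = \sum_(j < i.+1) lie_commutator f`_j h`_(i - j).
Proof. by rewrite coefB coefM coefMr -sumrB. Qed.

Lemma coef_linear_exp (A : nzRingType) (x y : A) n :
  ((x%:P * 'X + y%:P) ^+ n)`_n = x ^+ n /\
  forall i, (n < i)%N -> ((x%:P * 'X + y%:P) ^+ n)`_i = 0.
Proof.
elim: n => [|n [IH1 IH2]].
  by split=> [|[]//]; rewrite !expr0 ?coef1 // => i; rewrite coef1.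
have coefS i : ((x%:P * 'X + y%:P) ^+ n.+1)`_i.+1 =
    x * ((x%:P * 'X + y%:P) ^+ n)`_i + y * ((x%:P * 'X + y%:P) ^+ n)`_i.+1.
  by rewrite exprS mulrDl coefD -mulrA coefCM coefCM coefXM.
split; first by rewrite coefS IH1 IH2 // mulr0 addr0 -exprS.
by case=> // i lt_ni; rewrite coefS !IH2 ?mulr0 ?addr0 // ltnW.
Qed.

(** As t is central, [poly_br] computes commutators in U[t], where derivatives and evaluation are
    available. *)
Lemma iter_poly_br_coef (k : fieldType) (U : algType k) (F H : {poly U})
    (f h : nat -> U) n i :
  f =1 nth 0 F -> h =1 nth 0 H ->
  iter n (poly_br (@lie_commutator U) f) h i = (iter n (lie_commutator F) H)`_i.
Proof.
move=> fE hE; elim: n i => [|n IHn] i; first exact: hE.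
by rewrite !iterS coef_commutator; apply: eq_bigr => j _; rewrite fE IHn.
Qed.

(* The coefficients of [(t x + y) ^+ p] are compared with those of its
   derivative, which in characteristic p is [ad (t x + y)] iterated [p.-1]
   times on [x]. *)
Lemma jacobson_formula (k : fieldType) p (U : algType k) (x y : U) :
  p \in [pchar k] ->
  (x + y) ^+ p =
  x ^+ p + y ^+ p + \sum_(1 <= i < p) jacobson_s (@lie_commutator U) p i x y.
Proof.
move=> chp; have chU : p \in [pchar U] by rewrite pchar_lalg.
have p_gt0 := prime_gt0 (pcharf_prime chp).
pose F := x%:P * 'X + y%:P.
have F1 : comm_poly F 1 by rewrite /comm_poly mulr1 mul1r.
have F0 : comm_poly F 0 by rewrite /comm_poly mulr0 mul0r.
have FE : nth 0 [:: y; x] =1 nth 0 F.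
  by case=> [|[|i]]; rewrite /F coefD coefMX !coefC /= ?addr0 ?add0r ?nth_nil.
have xE : nth 0 [:: x] =1 nth 0 x%:P.
  by case=> [|i]; rewrite coefC //= nth_nil.
have derF : (F ^+ p)^`() = iter p.-1 (lie_commutator F) x%:P.
  rewrite deriv_exp_sum iter_commutator_pred_pchar ?pchar_poly //.
  by rewrite /F derivD derivC derivM derivC derivX mul0r add0r addr0 mulr1.
(* Differentiation multiplies the coefficient of t^i by i, which cancels the factor 1/i in s_i. *)
have sE i : (0 < i < p)%N ->
    jacobson_s (@lie_commutator U) p i x y = (F ^+ p)`_i.
  case: i => // i lt_ip.
  rewrite /jacobson_s (iter_poly_br_coef _ _ FE xE) -derF coef_deriv /=.
  rewrite -scaler_nat scalerA mulVf ?scale1r //.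
  rewrite -(dvdn_pcharf chp) gtnNdvd //.
have [Fp F_gt] := coef_linear_exp x y p.
(* Evaluation at 1 sums all coefficients; the top one is x^p, and evaluation at 0 shows that the
   constant one is y^p. *)
transitivity (F ^+ p).[1].
  by rewrite horner_exp_comm // /F hornerD hornerMX !hornerC mulr1.
rewrite (@horner_coef_wide _ p.+1); last first.
  by apply/leq_sizeP => i lt_pi; apply: F_gt.
under eq_bigr do rewrite expr1n mulr1.
rewrite -(big_mkord xpredT (fun i => (F ^+ p)`_i)) big_nat_recr //= Fp.
rewrite big_ltn // -horner_coef0 horner_exp_comm // horner_coef0 -(FE 0%N) /=.
rewrite addrC addrA; congr (_ + _).
by apply: eq_big_nat => i lt_ip; rewrite sE.
Qed.

(** * Elementary Lie algebra identities *)

Section LieAlgebra.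
Variables (k : fieldType) (L : lmodType k) (br : L -> L -> L).
Hypothesis hL : is_lie_algebra br.

Definition lie_ad (x : L) : {linear L -> L} :=
  HB.pack (br x) (GRing.isLinear.Build k L L *:%R (br x) (lie_linearr hL x)).

Lemma lie_br0 x : br x 0 = 0. Proof. exact: (linear0 (lie_ad x)). Qed.

Lemma lie_brDr x y z : br x (y + z) = br x y + br x z.
Proof. exact: (linearD (lie_ad x)). Qed.

Lemma lie_brMn x y n : br x (y *+ n) = br x y *+ n.
Proof. exact: (linearMn (lie_ad x)). Qed.

Lemma lie_brZr x a y : br x (a *: y) = a *: br x y.
Proof. exact: (linearZZ (lie_ad x)). Qed.

Lemma lie_br_sumr x I (r : seq I) P (F : I -> L) :
  br x (\sum_(i <- r | P i) F i) = \sum_(i <- r | P i) br x (F i).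
Proof. exact: (linear_sum (lie_ad x)). Qed.

Lemma lie_brDl x y z : br (x + y) z = br x z + br y z.
Proof. by have := lie_linearl hL z 1 x y; rewrite /= !scale1r. Qed.

Lemma lie_brC x y : br x y = - br y x.
Proof.
apply/eqP; rewrite -addr_eq0; have := lie_alternating hL (x + y).
by rewrite lie_brDl !lie_brDr !(lie_alternating hL) add0r addr0 => ->.
Qed.

Lemma lie_br0l x : br 0 x = 0.
Proof. by rewrite lie_brC lie_br0 oppr0. Qed.

Lemma lie_br_derivation r x y : br r (br x y) = br (br r x) y + br x (br r y).
Proof.
have /eqP := lie_jacobi hL r x y; rewrite -addrA addr_eq0 opprD => /eqP ->.
rewrite addrC -lie_brC; congr (_ + _).
by rewrite [br y r]lie_brC -(linearN (lie_ad x)) /= opprK.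
Qed.

End LieAlgebra.

(** * Sums of nested brackets over compositions *)

Lemma sum_tuple_cons (V : nmodType) (T : finType) n (P : pred (seq T))
    (F : seq T -> V) :
  \sum_(t : n.+1.-tuple T | P t) F t =
  \sum_(x : T) \sum_(t : n.-tuple T | P (x :: t)) F (x :: t).
Proof.
rewrite pair_big_dep /=.
rewrite (reindex (fun xt : T * n.-tuple T => [tuple of xt.1 :: xt.2])) //=.
exists (fun t : n.+1.-tuple T => (thead t, [tuple of behead t])) => [[x t] _|t _].
  by congr pair; apply: val_inj.
by rewrite [RHS]tuple_eta; apply: val_inj.
Qed.

(** C_alpha involves partial sums from the left, so removing the first parts, of sum [s], shifts all
    later factors; [s = 0] gives [comp_coef]. *)
Definition shifted_comp_coef (s : nat) (a : seq nat) : nat :=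
  (\prod_(j < size a) 'C((s + sumn (take j.+1 a)).-1, (nth 0 a j).-1))%N.

Lemma shifted_comp_coef_cons s b a :
  shifted_comp_coef s (b :: a) =
  ('C((s + b).-1, b.-1) * shifted_comp_coef (s + b) a)%N.
Proof.
rewrite /shifted_comp_coef big_ord_recl /= take0 /= addn0; congr muln.
by apply: eq_bigr => i _; rewrite /= addnA.
Qed.

(* The sum over the compositions of [n] with [r.+1] parts, obtained by peeling
   off the first part; [s] is the sum of the parts already removed. *)
Fixpoint comp_sum (k : fieldType) (L : lmodType k) (br : L -> L -> L)
    (X : nat -> L) (r s n : nat) : L :=
  if r is r'.+1 then
    \sum_(1 <= a < n.+1)
      br (X a) (comp_sum br X r' (s + a) (n - a)) *+ 'C((s + a).-1, a.-1)
  else if n is 0 then 0 else X n *+ 'C((s + n).-1, n.-1).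

Lemma comp_sum0 (k : fieldType) (L : lmodType k) (br : L -> L -> L)
    (X : nat -> L) r s :
  comp_sum br X r s 0 = 0.
Proof. by case: r => //= r; rewrite big_geq. Qed.

(** The bound on [n] ensures that every part of a composition of [n] lies in ['I_p.+1]. *)
Lemma comp_sumE (k : fieldType) (L : lmodType k) (br : L -> L -> L)
    (hL : is_lie_algebra br) (X : nat -> L) p r s n : (n <= p)%N ->
  \sum_(a : r.+1.-tuple 'I_p.+1 | is_composition n (map val a))
     (shifted_comp_coef s (map val a))%:R *: nested_br br (map X (map val a)) =
  comp_sum br X r s n.
Proof.
elim: r s n => [|r IHr] s n le_np.
  rewrite (sum_tuple_cons _ (fun a => is_composition n (map val a))
    (fun a => (shifted_comp_coef s (map val a))%:R *:
               nested_br br (map X (map val a)))) /=.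
  have inner (x : 'I_p.+1) :
      \sum_(t : 0.-tuple 'I_p.+1 | is_composition n (val x :: map val t))
        (shifted_comp_coef s (val x :: map val t))%:R *:
           nested_br br (X (val x) :: map X (map val t)) =
      if (0 < x)%N && (x == n :> nat) then X n *+ 'C((s + n).-1, n.-1) else 0.
    rewrite big_mkcond (big_pred1 [tuple]) => [|t]; last by rewrite /= [t]tuple0 [RHS]eqxx.
    rewrite /is_composition /= addn0 andbT.
    case: ifP => // /andP[_ /eqP ->]; rewrite scaler_nat shifted_comp_coef_cons.
    by rewrite /shifted_comp_coef big_ord0 muln1.
  under eq_bigr => x _ do rewrite inner.
  rewrite (bigD1 (inord n)) //= inordK ?ltnS // eqxx andbT.
  rewrite big1 ?addr0 => [|x]; first by case: n {le_np inner}.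
  by rewrite -val_eqE /= inordK ?ltnS // => /negbTE ->; rewrite andbF.
rewrite (sum_tuple_cons _ (fun a => is_composition n (map val a))
    (fun a => (shifted_comp_coef s (map val a))%:R *:
               nested_br br (map X (map val a)))) /=.
have inner (x : 'I_p.+1) :
    \sum_(t : r.+1.-tuple 'I_p.+1 | is_composition n (val x :: map val t))
      (shifted_comp_coef s (val x :: map val t))%:R *:
         nested_br br (X (val x) :: map X (map val t)) =
    if (0 < x <= n)%N
    then br (X x) (comp_sum br X r (s + x) (n - x)) *+ 'C((s + x).-1, x.-1)
    else 0.
  case: ifP => [/andP[x_gt0 le_xn]|x_out]; last first.
    rewrite big1 // => t /andP[/= /andP[x_gt0 _] /eqP sum_n].
    by rewrite x_gt0 -sum_n leq_addr in x_out.
  rewrite -IHr ?(leq_trans (leq_subr _ _)) // (lie_br_sumr hL) -sumrMnl.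
  apply: eq_big => t.
    by rewrite /is_composition /= x_gt0 -[in RHS](eqn_add2l x) subnKC.
  move=> _; rewrite shifted_comp_coef_cons natrM -scalerA scaler_nat.
  by rewrite (lie_brZr hL); case: t => -[].
under eq_bigr => x _ do rewrite inner.
rewrite -big_mkcond /=.
rewrite [RHS](big_nat_widenl _ 0%N) // (big_nat_widen _ _ p.+1) // big_mkord.
exact: eq_bigl.
Qed.

Lemma comp_sumSE (k : fieldType) (L : lmodType k) (br : L -> L -> L)
    (X : nat -> L) j s n :
  comp_sum br X j.+1 s n =
  \sum_(a < n) br (X a.+1) (comp_sum br X j (s + a).+1 (n - a.+1)) *+ 'C(s + a, a).
Proof.
rewrite /= big_add1 big_mkord; apply: eq_bigr => a _.
by rewrite addnS.
Qed.

Section CompSumRecurrence.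
Variables (k : fieldType) (L : lmodType k) (br : L -> L -> L).
Hypothesis hL : is_lie_algebra br.
Variables (r : L) (X : nat -> L).
(** The model is [X := rhd_pow br R x] with [r := R x]. Indices start at 1, since [rhd_pow] at 0 is
    again [x]. *)
Hypothesis br_rX : forall a, br r (X a.+1) = X a.+2.

(** Apply the recurrence for [j] to each tail, and expand [br r] as a derivation. Terms where [r]
    meets the tail cancel; those where it lengthens the first part are absorbed by Pascal's rule. *)
Let comp_sumS_rec j s n :
  (forall t m, comp_sum br X j t.+1 m.+1 =
     comp_sum br X j t m.+1 + br r (comp_sum br X j t.+1 m)) ->
  comp_sum br X j.+1 s n.+1 =
  br r (comp_sum br X j.+1 s n) +
  \sum_(a < n.+1) br (X a.+1) (comp_sum br X j (s + a) (n - a)) *+ 'C((s + a).-1, a).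
Proof.
move=> rec_j; rewrite !comp_sumSE.
have split_term (a : 'I_n.+1) :
    br (X a.+1) (comp_sum br X j (s + a).+1 (n.+1 - a.+1)) *+ 'C(s + a, a) =
    br (X a.+1) (comp_sum br X j (s + a) (n - a)) *+ 'C(s + a, a) +
    br (X a.+1) (br r (comp_sum br X j (s + a).+1 (n - a.+1))) *+ 'C(s + a, a).
  rewrite subSS -mulrnDl -(lie_brDr hL) subnS.
  by case: (n - a)%N => [|m]; rewrite /= ?rec_j // !comp_sum0 (lie_br0 hL r) addr0.
rewrite (eq_bigr _ (fun a _ => split_term a)) big_split /=.
rewrite [X in _ + X = _]big_ord_recr /= subnS subnn comp_sum0 !(lie_br0 hL).
rewrite mul0rn addr0 (lie_br_sumr hL).
under [X in _ = X + _]eq_bigr => a _ do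
  rewrite (lie_brMn hL) (lie_br_derivation hL) br_rX mulrnDl.
rewrite big_split /= [RHS]addrAC; congr (_ + _).
rewrite !big_ord_recl /= !bin0 [RHS]addrCA; congr (_ + _).
rewrite -big_split; apply: eq_bigr => a _ /=.
by rewrite /bump !add1n !addnS /= binS mulrnDr addrC.
Qed.

Lemma comp_sumS j s n :
  comp_sum br X j s.+1 n.+1 =
  comp_sum br X j s n.+1 + br r (comp_sum br X j s.+1 n).
Proof.
elim: j s n => [|j IHj] s n.
  case: n => [|n]; first by rewrite /= (lie_br0 hL) addr0 !bin0.
  by rewrite /= (lie_brMn hL) br_rX -mulrnDr !addnS.
rewrite comp_sumS_rec // addrC; congr (_ + _).
by rewrite comp_sumSE; apply: eq_bigr => a _; rewrite addSn.
Qed.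

Lemma comp_sum_br j n :
  comp_sum br X j.+1 0 n.+1 =
  br (X 1%N) (comp_sum br X j 0 n) + br r (comp_sum br X j.+1 0 n).
Proof.
rewrite comp_sumS_rec => [|t m]; last exact: comp_sumS.
(* For [s = 0] the coefficient is ['C(a.-1, a)]: it is 1 at a = 0, as [0.-1] is 0, and vanishes for
   a > 0. Only a first part equal to 1 survives. *)
rewrite addrC; congr (_ + _); rewrite big_ord_recl big1 => [|a _]; last first.
  by rewrite /= /bump add1n add0n /= bin_small ?mulr0n.
by rewrite /= subn0 addr0.
Qed.

(** Both sides obey the recurrence [comp_sum_br]: bracketing with t X_1 raises the degree in t,
    bracketing with [r] does not. *)
Lemma comp_sum_poly_br n i :
  iter n (poly_br br (nth 0 [:: r; X 1%N])) (nth 0 [:: X 1%N]) i =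
  comp_sum br X i 0 n.+1.
Proof.
elim: n i => [|n IHn] [|i].
- by rewrite /= binn mulr1n.
- by rewrite comp_sumSE big_ord1 comp_sum0 (lie_br0 hL) mul0rn /= nth_nil.
- by rewrite iterS /poly_br big_ord1 /= IHn /= !binn !mulr1n br_rX.
rewrite iterS comp_sum_br -!IHn /poly_br !big_ord_recl big1 => [|a _].
  by rewrite addr0 addrC /= subn1.
by rewrite /= nth_nil (lie_br0l hL).
Qed.

End CompSumRecurrence.

(** Expand [pm (x + R x)] by Jacobson's formula: s_r involves the coefficient of t^(r-1), which is
    the sum over compositions of p with r parts. *)
Lemma pmapR_restricted (k : fieldType) p (L : lmodType k) (br : L -> L -> L)
    (pm R : L -> L) (x : L) : is_restricted_lie p br pm ->
  (0 < p)%N -> pmapR p 1 br pm R x = pm (x + R x) - pm (R x).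
Proof.
move=> hL p_gt0; have lieL := restricted_lie hL.
rewrite (pmapD hL) [RHS]addrAC addrK [LHS]/pmapR expr1n scale1r addrC.
rewrite [RHS]addrC; congr (_ + _).
apply: eq_big_nat => -[|i] //= lt_ip; rewrite expr1n mulr1; congr (_ *: _).
have rec a : br (R x) (rhd_pow br R x a.+1) = rhd_pow br R x a.+2 by [].
rewrite -[p in RHS](prednK p_gt0) /= (comp_sum_poly_br lieL rec) prednK //.
by rewrite -(comp_sumE lieL _ _ _ (leqnn p)).
Qed.

(** * Linear spans, commutators, and transfer along linear maps *)

Lemma in_span_ind (k : fieldType) (V : lmodType k) (S : V -> Prop)
    (Q : V -> Prop) :
  Q 0 -> (forall a u v, Q u -> Q v -> Q (a *: u + v)) ->
  (forall u, S u -> Q u) -> forall u, u \in in_span S -> Q u.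
Proof.
move=> Q0 QD QS u /asboolP[n [c [v [Sv ->]]]].
elim: n c v Sv => [|n IHn] c v Sv; first by rewrite big_ord0.
by rewrite big_ord_recl; apply: QD; [apply: QS | apply: IHn].
Qed.

Lemma mem_in_span (k : fieldType) (V : lmodType k) (S : V -> Prop) u :
  S u -> u \in in_span S.
Proof.
move=> Su; apply/asboolP; exists 1%N, (fun=> 1), (fun=> u).
by rewrite big_ord1 scale1r.
Qed.

Lemma iter_poly_br_ind (k : fieldType) (L : lmodType k) (br : L -> L -> L)
    (Q : L -> Prop) (f h : nat -> L) n i :
  Q 0 -> (forall u v, Q u -> Q v -> Q (u + v)) ->
  (forall j u, Q u -> Q (br (f j) u)) -> (forall j, Q (h j)) ->
  Q (iter n (poly_br br f) h i).
Proof.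
move=> Q0 QD Qbr Qh; elim: n i => [|n IHn] i //=.
by apply: (big_ind Q) => // j _; apply: Qbr.
Qed.

Lemma iter_poly_br_morph (k : fieldType) (L M : lmodType k)
    (brL : L -> L -> L) (brM : M -> M -> M) (phi : {linear L -> M})
    (fL hL : nat -> L) (fM hM : nat -> M) n i :
  (forall x y, phi (brL x y) = brM (phi x) (phi y)) ->
  phi \o fL =1 fM -> phi \o hL =1 hM ->
  phi (iter n (poly_br brL fL) hL i) = iter n (poly_br brM fM) hM i.
Proof.
move=> phi_br fE hE; elim: n i => [|n IHn] i; first exact: hE.
rewrite !iterS /poly_br linear_sum; apply: eq_bigr => j _.
by rewrite phi_br IHn -fE.
Qed.

Lemma jacobson_s_morph (k : fieldType) (L M : lmodType k)
    (brL : L -> L -> L) (brM : M -> M -> M) (phi : {linear L -> M}) p i x y :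
  (forall u v, phi (brL u v) = brM (phi u) (phi v)) ->
  phi (jacobson_s brL p i x y) = jacobson_s brM p i (phi x) (phi y).
Proof.
move=> phi_br; rewrite /jacobson_s linearZ /=; congr (_ *: _).
apply: iter_poly_br_morph => //.
  by case=> [|[|j]] //=; rewrite !nth_nil linear0.
by case=> [|j] //=; rewrite !nth_nil linear0.
Qed.

Lemma commutator_linearl (k : fieldType) (U : algType k) (y : U) :
  linear (fun x => lie_commutator x y).
Proof.
move=> a u v; rewrite /lie_commutator mulrDl mulrDr -scalerAl -scalerAr.
by rewrite scalerBr opprD addrACA.
Qed.

Lemma commutator_linearr (k : fieldType) (U : algType k) (x : U) :
  linear (lie_commutator x).
Proof.
move=> a u v; rewrite /lie_commutator mulrDl mulrDr -scalerAl -scalerAr.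
by rewrite scalerBr opprD addrACA.
Qed.

Lemma commutatorC (A : pzRingType) (x y : A) :
  lie_commutator x y = - lie_commutator y x.
Proof. by rewrite /lie_commutator opprB. Qed.

Lemma commutatorBr (A : pzRingType) (x y z : A) :
  lie_commutator x (y - z) = lie_commutator x y - lie_commutator x z.
Proof. by rewrite /lie_commutator mulrBl mulrBr !opprD addrACA. Qed.

Lemma commutatorM (A : pzRingType) (x y z : A) :
  lie_commutator x (y * z) = lie_commutator x y * z + y * lie_commutator x z.
Proof. by rewrite /lie_commutator mulrBl mulrBr !mulrA subrKA. Qed.

Lemma commutator_lie (k : fieldType) (U : algType k) :
  is_lie_algebra (@lie_commutator U).
Proof.
split=> [y|x|x|x y z]; [exact: commutator_linearl|exact: commutator_linearr| |].
  exact: subrr.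
(* Jacobi's identity holds because ad x is a derivation of the product, hence of the commutator. *)
have ->: lie_commutator x (lie_commutator y z) =
    lie_commutator (lie_commutator x y) z + lie_commutator y (lie_commutator x z).
  rewrite [lie_commutator y z]/lie_commutator.
  rewrite commutatorBr !commutatorM opprD [- _ - _]addrC addrACA.
  by rewrite [in RHS]/lie_commutator.
rewrite [lie_commutator z (lie_commutator x y)]commutatorC addrAC.
rewrite [_ + _ - _]addrAC subrr add0r [lie_commutator z x]commutatorC -sub0r.
by rewrite (commutatorBr y 0) addrCA subrr addr0 /lie_commutator mul0r mulr0 subrr.
Qed.

Lemma lie_algebra_inj (k : fieldType) (L M : lmodType k)
    (brL : L -> L -> L) (brM : M -> M -> M) (phi : {linear L -> M}) :
  (forall x y, phi (brL x y) = brM (phi x) (phi y)) -> injective phi ->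
  is_lie_algebra brM -> is_lie_algebra brL.
Proof.
move=> phi_br phi_inj hM; split=> [y a u v|x a u v|x|x y z]; apply: phi_inj.
- by rewrite !(phi_br, linearP) (lie_linearl hM).
- by rewrite !(phi_br, linearP) (lie_linearr hM).
- by rewrite phi_br linear0 (lie_alternating hM).
- by rewrite !(linearD, phi_br) linear0 (lie_jacobi hM).
Qed.

(** The axioms hold for commutators and p-th powers in U, the last one by [jacobson_formula];
    injectivity reflects them. *)
Lemma restricted_lie_inj (k : fieldType) p (U : algType k) (L : lmodType k)
    (br : L -> L -> L) (pm : L -> L) (phi : {linear L -> U}) :
  p \in [pchar k] -> injective phi ->
  (forall x y, phi (br x y) = lie_commutator (phi x) (phi y)) ->
  (forall x, phi (pm x) = phi x ^+ p) ->
  is_restricted_lie p br pm.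
Proof.
move=> chp phi_inj phi_br phi_pm.
have chU : p \in [pchar U] by rewrite pchar_lalg.
split=> [|a x|x y|x y].
- exact: lie_algebra_inj phi_br phi_inj (commutator_lie U).
- by apply: phi_inj; rewrite phi_pm !linearZ /= phi_pm exprZn.
- apply: phi_inj; rewrite phi_br phi_pm -(iter_commutator_pchar _ _ chU).
  by elim: p {chp chU phi_pm} => //= n ->; rewrite phi_br.
- apply: phi_inj; rewrite phi_pm !linearD /= !phi_pm linear_sum /=.
  rewrite (jacobson_formula _ _ chp); congr (_ + _).
  by apply: eq_bigr => i _; rewrite (jacobson_s_morph _ _ _ _ phi_br).
Qed.

(** * The span of the p-power elements and the action of [RU] on it *)

Section RotaBaxterEnveloping.
Variables (k : fieldType) (p : nat).
Hypothesis chp : p \in [pchar k].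
Variables (g : lmodType k) (br : g -> g -> g) (R : {linear g -> g}).
Variables (U : algType k) (iota : {linear g -> U}).
Hypothesis iota_br :
  forall x y, iota (br x y) = lie_commutator (iota x) (iota y).
Variable RU : {linear U -> U}.
Hypothesis hRU : is_rb_extension iota R RU.

Local Notation S := (fun u : U => exists (x : g) (n : nat), u = iota x ^+ (p ^ n)).
Local Notation from_g u := (exists z, u = iota z).

Let chU : p \in [pchar U]. Proof. by rewrite pchar_lalg. Qed.

Lemma iota_in_span x : iota x \in in_span S.
Proof. by apply: mem_in_span; exists x, 0%N; rewrite expn0 expr1. Qed.

Lemma iter_commutator_ppow n (x y : U) :
  iter (p ^ n) (lie_commutator x) y = lie_commutator (x ^+ (p ^ n)) y.
Proof.
elim: n x y => [|n IHn] x y; first by rewrite expn0 expr1.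
rewrite expnS exprM -IHn.
elim: (p ^ n)%N (y) => [|m IHm] z; first by rewrite muln0.
by rewrite mulnS iterD iterS IHm iter_commutator_pchar.
Qed.

Lemma iter_commutator_iota n x z : from_g (iter n (lie_commutator (iota x)) (iota z)).
Proof.
elim: n => [|n [y IHn]]; first by exists z.
by exists (br x y); rewrite iterS IHn iota_br.
Qed.

(** Since ad (y^(p^n)) = (ad y)^(p^n), the innermost of these brackets is [y, x^(p^m)] = - (ad
    x)^(p^m) y, already in the image of g; the outer ones stay there. *)
Lemma commutator_ppow_from_g x y m n :
  from_g (lie_commutator (iota x ^+ (p ^ m)) (iota y ^+ (p ^ n))).
Proof.
have p_gt0 := prime_gt0 (pcharf_prime chp).
rewrite commutatorC -iter_commutator_ppow.
rewrite -(prednK (_ : 0 < p ^ n)%N) ?expn_gt0 ?p_gt0 // iterSr.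
rewrite [lie_commutator (iota y) _]commutatorC -iter_commutator_ppow.
have [z ->] := iter_commutator_iota (p ^ m) x y.
have [w] := iter_commutator_iota (p ^ n).-1 y (- z).
by rewrite linearN => ->; exists (- w); rewrite linearN.
Qed.

Lemma commutator_span_from_g u v :
  u \in in_span S -> v \in in_span S -> from_g (lie_commutator u v).
Proof.
move=> Su Sv; elim/in_span_ind: u / Su => [|a u w [x ux] [y wy]|u [x [m ->]]].
- by exists 0; rewrite (lie_br0l (commutator_lie U)) linear0.
- by exists (a *: x + y); rewrite commutator_linearl ux wy linearP.
elim/in_span_ind: v / Sv => [|a v w [y vy] [z wz]|v [y [n ->]]].
- by exists 0; rewrite (lie_br0 (commutator_lie U)) linear0.
- by exists (a *: y + z); rewrite commutator_linearr vy wz linearP.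
exact: commutator_ppow_from_g.
Qed.

Lemma commutator_in_span u v :
  u \in in_span S -> v \in in_span S -> lie_commutator u v \in in_span S.
Proof.
by move=> Su Sv; have [z ->] := commutator_span_from_g Su Sv; apply: iota_in_span.
Qed.

Lemma jacobson_s_from_g i u v : u \in in_span S -> v \in in_span S ->
  from_g (jacobson_s (@lie_commutator U) p i u v).
Proof.
move=> Su Sv; rewrite /jacobson_s.
have Sf j : nth 0 [:: v; u] j \in in_span S.
  by case: j => [|[|j]] //=; rewrite nth_nil rpred0.
have Sh j : nth 0 [:: u] j \in in_span S.
  by case: j => [|j] //=; rewrite nth_nil rpred0.
have gD x y : from_g x -> from_g y -> from_g (x + y).
  by move=> [x' ->] [y' ->]; exists (x' + y'); rewrite linearD.
have g0 : from_g (0 : U) by exists 0; rewrite linear0.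
suff [z ->] : from_g (iter p.-1 (poly_br (@lie_commutator U) (nth 0 [:: v; u]))
                        (nth 0 [:: u]) i.-1).
  by exists ((i%:R)^-1 *: z); rewrite linearZ.
(* As p > 1 there is at least one bracket; the innermost one lands in the image of g. *)
have := prime_gt1 (pcharf_prime chp); case: (p) => [|[|q]] //= _.
rewrite -iterS iterSr.
apply: (@iter_poly_br_ind _ _ _ (fun x => from_g x)) => // j.
  by move=> _ [z ->]; apply: commutator_span_from_g; rewrite ?iota_in_span.
rewrite /poly_br; apply: (big_ind (fun x => from_g x)) => // l _.
exact: commutator_span_from_g.
Qed.

Lemma sum_jacobson_from_g u v : u \in in_span S -> v \in in_span S ->
  from_g (\sum_(1 <= i < p) jacobson_s (@lie_commutator U) p i u v).
Proof.
move=> Su Sv; apply: (big_ind (fun x => from_g x)) => [|x y [x' ->] [y' ->]|i _].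
- by exists 0; rewrite linear0.
- by exists (x' + y'); rewrite linearD.
- exact: jacobson_s_from_g.
Qed.

Lemma exp_in_span u : u \in in_span S -> u ^+ p \in in_span S.
Proof.
(* Membership is carried along because the linear step needs it to control Jacobson's sum. *)
move=> Su; suff []: u \in in_span S /\ u ^+ p \in in_span S by [].
elim/in_span_ind: u / Su => [|a u v [Su Sup] [Sv Svp]|u [x [n ->]]].
- by rewrite expr0n (negbTE (lt0n_neq0 (prime_gt0 (pcharf_prime chp)))) !rpred0.
- have Sau : a *: u \in in_span S by rewrite rpredZ.
  split; first by rewrite rpredD.
  rewrite (jacobson_formula _ _ chp) exprZn.
  have [z ->] := sum_jacobson_from_g Sau Sv.
  by rewrite !rpredD ?rpredZ // iota_in_span.
split; apply: mem_in_span; first by exists x, n.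
by exists x, n.+1; rewrite -exprM expnSr.
Qed.

(* For [u] primitive this is the Rota-Baxter identity of the Hopf algebra [U]. *)
Definition rb_left (u : U) : Prop :=
  forall w, RU (u * w) = RU u * RU w - RU (lie_commutator (RU u) w).

Lemma rb_left_iota x : rb_left (iota x).
Proof. exact: rb_extM hRU x. Qed.

Lemma rb_left0 : rb_left 0.
Proof.
move=> w; rewrite mul0r linear0 mul0r (lie_br0l (commutator_lie U)) linear0.
by rewrite subr0.
Qed.

Lemma rb_left_linear a u v : rb_left u -> rb_left v -> rb_left (a *: u + v).
Proof.
move=> Pu Pv w; rewrite mulrDl -scalerAl !linearP Pu Pv commutator_linearl.
rewrite linearP mulrDl -scalerAl scalerBr opprD.
by rewrite addrACA.
Qed.

(* Left and right multiplications commute, so [w |-> u w + [RU u, w]], that is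
   [w |-> (u + RU u) w - w RU u], has [p]-th power
   [w |-> (u + RU u) ^+ p w - w (RU u) ^+ p]. *)
Lemma rb_left_exp u : rb_left u ->
  RU ((u + RU u) ^+ p - RU u ^+ p) = RU u ^+ p /\
  rb_left ((u + RU u) ^+ p - RU u ^+ p).
Proof.
move=> Pu; set r := RU u.
have RUT w : RU ((u + r) * w - w * r) = r * RU w.
  rewrite mulrDl -addrA linearD Pu -/r /lie_commutator.
  by rewrite subrK.
have RUTp w : RU ((u + r) ^+ p * w - w * r ^+ p) = r ^+ p * RU w.
  rewrite -iter_mul_sub_pchar //.
  by elim: (p) => [|n IHn]; rewrite ?mul1r // iterS RUT IHn mulrA -exprS.
(* Take w = 1, where RU 1 = 1. *)
have RUv : RU ((u + r) ^+ p - r ^+ p) = r ^+ p.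
  by have := RUTp 1; rewrite mulr1 mul1r (rb_ext1 hRU) mulr1.
(* With v = (u + r)^p - r^p, one has v w + [r^p, w] = (u + r)^p w - w r^p. *)
split=> // w; rewrite RUv -RUTp -linearB; congr (RU _).
by rewrite /lie_commutator mulrBl opprB subrKA.
Qed.

(** The claims are proved together: [RU u] must lie in the span for Jacobson's sum of [u] and [RU u]
    to lie in the image of g. *)
Lemma rb_left_span u : u \in in_span S -> rb_left u /\ RU u \in in_span S.
Proof.
move=> Su; elim/in_span_ind: u / Su => [|a u v [Pu Su] [Pv Sv]|_ [x [n ->]]].
- by split; [exact: rb_left0 | rewrite linear0 rpred0].
- by split; [exact: rb_left_linear | rewrite linearP rpredD ?rpredZ].
elim: n => [|n [Pu Su]].
  rewrite expn0 expr1; split; first exact: rb_left_iota.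
  by rewrite (rb_ext_iota hRU) iota_in_span.
rewrite expnSr exprM; set u := iota x ^+ (p ^ n) in Pu Su *.
have Su0 : u \in in_span S by apply: mem_in_span; exists x, n.
have [RUv Pv] := rb_left_exp Pu.
have [z sumE] := sum_jacobson_from_g Su0 Su.
have upE : u ^+ p = (u + RU u) ^+ p - RU u ^+ p - iota z.
  by rewrite (jacobson_formula _ _ chp) sumE [_ + iota z - _]addrAC !addrK.
rewrite upE; split.
  rewrite addrC -scaleN1r; apply: rb_left_linear => //; exact: rb_left_iota.
by rewrite linearB RUv (rb_ext_iota hRU) rpredB ?exp_in_span ?iota_in_span.
Qed.

(** Subtract the [rb_left] identities for the products [u * v] and [v * u]. *)
Lemma rb_span_identity u v : u \in in_span S -> v \in in_span S ->
  lie_commutator (RU u) (RU v) =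
  RU (lie_commutator (RU u) v) + RU (lie_commutator u (RU v)) +
  RU (lie_commutator u v).
Proof.
move=> /rb_left_span[Pu _] /rb_left_span[Pv _].
have uv := Pu v; have vu := Pv u.
move/eqP: uv; rewrite eq_sym subr_eq => /eqP uv.
move/eqP: vu; rewrite eq_sym subr_eq => /eqP vu.
rewrite [LHS]/lie_commutator uv vu [lie_commutator u (RU v)]commutatorC.
rewrite linearN [lie_commutator u v]/lie_commutator (linearB RU (u * v)) opprD.
by rewrite [RHS]addrC addrACA.
Qed.

End RotaBaxterEnveloping.

(** * The restricted Rota-Baxter structure on the span *)

Theorem theorem4p17 (k : fieldType) (p : nat) (hp : p \in [pchar k])
    (g : lmodType k) (br : g -> g -> g) (R : {linear g -> g})
    (hg : is_rota_baxter_lie 1 br R)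
    (U : algType k) (iota : {linear g -> U})
    (hU : is_enveloping_algebra br iota)
    (RU : {linear U -> U}) (hRU : is_rb_extension iota R RU) :
  exists (br' : ppower_span p iota -> ppower_span p iota ->
                ppower_span p iota)
         (pm : ppower_span p iota -> ppower_span p iota)
         (R' : {linear ppower_span p iota -> ppower_span p iota}),
    [/\ forall x y,
          span_val (br' x y) = lie_commutator (span_val x) (span_val y),
        forall x, span_val (pm x) = span_val x ^+ p,
        forall x, span_val (R' x) = RU (span_val x)
      & is_restricted_rota_baxter_lie p 1 br' pm R'].
Proof.
have iota_br := env_br hU.
pose phi : {linear ppower_span p iota -> U} := \val.
have phi_inj : injective phi by exact: val_inj.
have phiP x : phi x \in
    in_span (fun u : U => exists (y : g) (n : nat), u = iota y ^+ (p ^ n)).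
  by case: x.
pose br' x y : ppower_span p iota :=
  Span (commutator_in_span hp iota_br (phiP x) (phiP y)).
pose pm x : ppower_span p iota := Span (exp_in_span hp iota_br (phiP x)).
pose R0 x : ppower_span p iota :=
  Span (rb_left_span hp iota_br hRU (phiP x)).2.
have phi_R0 x : phi (R0 x) = RU (phi x) by [].
have R0_linear : linear R0.
  by move=> a x y; apply: phi_inj; rewrite linearP !phi_R0 !linearP.
pose R' : {linear ppower_span p iota -> ppower_span p iota} :=
  HB.pack R0 (GRing.isLinear.Build k _ _ *:%R R0 R0_linear).
have phi_br x y : phi (br' x y) = lie_commutator (phi x) (phi y) by [].
have phi_pm x : phi (pm x) = phi x ^+ p by [].
have phi_R x : phi (R' x) = RU (phi x) by [].
have restr := restricted_lie_inj hp phi_inj phi_br phi_pm.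
exists br', pm, R'; split=> //; split=> // [|x].
  split=> [|x y]; first exact: restricted_lie restr.
  apply: phi_inj; rewrite scale1r !(linearD phi) !(phi_br, phi_R).
  exact: (rb_span_identity hp iota_br hRU).
(* In U this value is (u + RU u)^p - (RU u)^p for u = [phi x], which [rb_left_exp] sends to (RU
   u)^p. *)
rewrite (pmapR_restricted _ _ restr) ?(prime_gt0 (pcharf_prime hp)) //.
apply: phi_inj; rewrite phi_R phi_pm (linearB phi) !phi_pm (linearD phi) !phi_R.
by have [] := rb_left_exp hp hRU (rb_left_span hp iota_br hRU (phiP x)).1.
Qed.
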